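(* Let $k$ be an algebraically closed field and let $Q$ be a star quiver with three arms. For any two exceptional representations $\rho,\rho'\in\mathrm{Rep}_k(Q)$ we have $\mathrm{Hom}(\rho,\rho')=0$ or $\mathrm{Ext}^1(\rho,\rho')=0$, provided that $\rho$ or $\rho'$ is a thin representation.
   Context: A star quiver with three arms is a quiver, with any orientation of the arrows, whose underlying graph consists of a central vertex $s$ with three arms attached: paths $u_1-\cdots-u_{m-1}-s$, $v_1-\cdots-v_{n-1}-s$, $w_1-\cdots-w_{p-1}-s$ with $m,n,p\geq 2$, disjoint apart from $s$. $\mathrm{Rep}_k(Q)$ is the category of finite-dimensional $k$-representations of $Q$. A representation $\rho$ is exceptional if $\mathrm{Hom}(\rho,\rho)=k$ and $\mathrm{Ext}^1(\rho,\rho)=0$. A representation is thin if all components of its dimension vector lie in $\{0,1\}$. *)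

(* Defs.v *)
From HB Require Import structures.
From mathcomp Require Import all_boot all_order all_algebra.
Set Implicit Arguments.
Unset Strict Implicit.
Unset Printing Implicit Defensive.
Import GRing.Theory.
Local Open Scope ring_scope.

Record quiver := Quiver {
  vertex : finType;
  arrow : finType;
  src : arrow -> vertex;
  tgt : arrow -> vertex
}.
Arguments src {q} a.
Arguments tgt {q} a.

(* Vertices of the star: [None] is the centre s, and the three summands are   *)
(* u_1 .. u_(m-1), v_1 .. v_(n-1), w_1 .. w_(p-1), numbered from 0.           *)
Definition arm_vertex (m n p : nat) : finType := ('I_m.-1 + 'I_n.-1 + 'I_p.-1)%type.
Definition star_vertex (m n p : nat) : finType := option (arm_vertex m n p).

(* The neighbour of an arm vertex on the side of the centre; [insub i.+1] is  *)
(* [None], hence the centre, when i is the last vertex of its arm. The edges  *)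
(* of the star are the pairs {x, star_next x}, so they are indexed by x.      *)
Definition star_next (m n p : nat) (x : arm_vertex m n p) : star_vertex m n p :=
  match x with
  | inl (inl i) => omap (fun j : 'I_m.-1 => inl (inl j)) (insub i.+1)
  | inl (inr i) => omap (fun j : 'I_n.-1 => inl (inr j)) (insub i.+1)
  | inr i => omap (fun j : 'I_p.-1 => inr j) (insub i.+1)
  end.

(* [phi] and [psi] identify the underlying graph of Q with the star; the      *)
(* disjunction leaves the orientation of each arrow free.                     *)
Definition three_arm_star (Q : quiver) : Prop :=
  exists m n p : nat, [/\ (2 <= m)%N, (2 <= n)%N, (2 <= p)%N &
    exists (phi : vertex Q -> star_vertex m n p)
           (psi : arrow Q -> arm_vertex m n p),
      [/\ bijective phi, bijective psi &
        forall a : arrow Q,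
          (phi (src a) = Some (psi a) /\ phi (tgt a) = star_next (psi a)) \/
          (phi (src a) = star_next (psi a) /\ phi (tgt a) = Some (psi a))]].

Section Representations.
Variables (k : fieldType) (Q : quiver).

Record rep := Rep {
  space :> vertex Q -> vectType k;
  rmap : forall a : arrow Q, 'Hom(space (src a), space (tgt a))
}.

Record rep_hom (V W : rep) := RepHom {
  hom_at :> forall i : vertex Q, 'Hom(V i, W i);
  hom_comm : forall a : arrow Q,
    (hom_at (tgt a) \o rmap V a)%VF = (rmap W a \o hom_at (src a))%VF
}.

Definition Hom_eq0 (V W : rep) : Prop :=
  forall (f : rep_hom V W) (i : vertex Q), f i = 0.

(* Hom(V, V) = k: the canonical map from k to Hom(V, V) is bijective. Its     *)
(* injectivity, i.e. uniqueness of c, rules out V = 0.                        *)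
Definition End_eq_scalars (V : rep) : Prop :=
  forall f : rep_hom V V,
    exists! c : k, forall i : vertex Q, f i = c *: \1%VF.

(* A short exact sequence 0 -> W -> E -> V -> 0. *)
Record extension (V W : rep) := Extension {
  ext_mid : rep;
  ext_in : rep_hom W ext_mid;
  ext_out : rep_hom ext_mid V;
  ext_in_inj : forall i : vertex Q, lker (ext_in i) = 0%VS;
  ext_exact : forall i : vertex Q, limg (ext_in i) = lker (ext_out i);
  ext_out_surj : forall i : vertex Q, limg (ext_out i) = fullv
}.

(* Yoneda equivalence; the morphism is an isomorphism by the five lemma. *)
Definition ext_equiv (V W : rep) (e e' : extension V W) : Prop :=
  exists h : rep_hom (ext_mid e) (ext_mid e'),
    forall i : vertex Q,
      (h i \o ext_in e i)%VF = ext_in e' i /\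
      (ext_out e' i \o h i)%VF = ext_out e i.

Section PairMaps.
Variables A B C D : vectType k.

Definition pair_fun (f : 'Hom(A, B)) (g : 'Hom(C, D)) (x : A * C) : B * D :=
  (f x.1, g x.2).
Lemma pair_fun_linear f g : linear (pair_fun f g).
Proof. by move=> a x y; rewrite /pair_fun /= !linearP. Qed.
HB.instance Definition _ f g :=
  GRing.isLinear.Build k (A * C)%type (B * D)%type *:%R (pair_fun f g)
    (pair_fun_linear f g).

Definition inr_fun (x : C) : A * C := (0, x).
Lemma inr_fun_linear : linear inr_fun.
Proof.
by move=> a x y; rewrite /inr_fun; congr (_, _); rewrite /= scaler0 addr0.
Qed.
HB.instance Definition _ :=
  GRing.isLinear.Build k C (A * C)%type *:%R inr_fun inr_fun_linear.

Definition fst_fun (x : A * C) : A := x.1.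
Lemma fst_fun_linear : linear fst_fun.
Proof. by []. Qed.
HB.instance Definition _ :=
  GRing.isLinear.Build k (A * C)%type A *:%R fst_fun fst_fun_linear.

End PairMaps.

Section SplitExtension.
Variables V W : rep.

Definition rep_sum : rep :=
  @Rep (fun i => (V i * W i)%type)
    (fun a => linfun (pair_fun (rmap V a) (rmap W a))).

Lemma sum_in_comm (a : arrow Q) :
  (linfun (@inr_fun (V (tgt a)) (W (tgt a))) \o rmap W a)%VF
  = (rmap rep_sum a \o linfun (@inr_fun (V (src a)) (W (src a))))%VF.
Proof.
by apply/lfunP=> x; rewrite !comp_lfunE !lfunE /= /pair_fun /inr_fun /= linear0.
Qed.

Lemma sum_out_comm (a : arrow Q) :
  (linfun (@fst_fun (V (tgt a)) (W (tgt a))) \o rmap rep_sum a)%VF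
  = (rmap V a \o linfun (@fst_fun (V (src a)) (W (src a))))%VF.
Proof. by apply/lfunP=> x; rewrite !comp_lfunE !lfunE. Qed.

Definition sum_in : rep_hom W rep_sum :=
  @RepHom W rep_sum (fun i => linfun (@inr_fun (V i) (W i))) sum_in_comm.
Definition sum_out : rep_hom rep_sum V :=
  @RepHom rep_sum V (fun i => linfun (@fst_fun (V i) (W i))) sum_out_comm.

Lemma sum_in_inj (i : vertex Q) : lker (sum_in i) = 0%VS.
Proof.
by apply/eqP/lker0P=> x y; rewrite !lfunE /= /inr_fun => -[].
Qed.

Lemma sum_exact (i : vertex Q) : limg (sum_in i) = lker (sum_out i).
Proof.
apply/vspaceP=> x; rewrite memv_ker lfunE /= /fst_fun; apply/memv_imgP/eqP.
  by case=> y _ ->; rewrite lfunE.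
move=> x0; exists x.2; first exact: memvf.
by rewrite lfunE /= /inr_fun -x0; case: x {x0}.
Qed.

Lemma sum_out_surj (i : vertex Q) : limg (sum_out i) = fullv.
Proof.
apply/vspaceP=> x; rewrite memvf; apply/memv_imgP.
by exists (x, 0); rewrite ?memvf // lfunE.
Qed.

Definition split_ext : extension V W :=
  Extension sum_in_inj sum_exact sum_out_surj.

End SplitExtension.

(* Ext^1(V, W) is the group of extensions of V by W up to Yoneda equivalence, *)
(* with the class of the split extension as zero.                             *)
Definition Ext1_eq0 (V W : rep) : Prop :=
  forall e : extension V W, ext_equiv e (split_ext V W).

Definition exceptional (V : rep) : Prop := End_eq_scalars V /\ Ext1_eq0 V V.

Definition thin (V : rep) : Prop :=
  forall i : vertex Q, (\dim {: V i} <= 1)%N.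

End Representations.

(* Main.v *)
From HB Require Import structures.
From Stdlib Require Import Classical.
Require Import Defs.
From mathcomp Require Import all_boot all_order all_algebra zify.
Set Implicit Arguments.
Unset Strict Implicit.
Unset Printing Implicit Defensive.
Import GRing.Theory.
Local Open Scope ring_scope.

(** Why the theorem holds. Let R be a thin exceptional representation and V an
    exceptional one, and let F : R -> V be a nonzero morphism; the point is
    that Ext^1(R, V) = 0. The mirror statement for morphisms V -> R follows by
    duality, which turns a star into the star with all arrows reversed.

    Over a tree, Ext^1(V, W) is the cokernel of the map sending a family of
    linear maps (G_i : V_i -> W_i) to its defects of commutation with the
    arrows ([Ext1_eq0_split], [split_Ext1_eq0]), so Ext^1(R, V) = 0 means that
    every family eta of defects is attained.

    Pick a root c with V_c != 0: the centre of the star if V does not vanish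
    there, and otherwise a vertex where F is nonzero, in which case V lives on
    a single arm ([brick_in_arm], [star_reroot]). Seen from c the support of V
    is a bunch of paths, and on a brick V every arrow pointing toward c acts
    injectively, every arrow pointing away from c acts surjectively
    ([brick_tight]). Otherwise the failure would be carried by a nonzero
    endomorphism of V living on the far side of that arrow, which vanishes at
    c and hence is not a scalar.

    The thin brick R has connected support and invertible maps on it
    ([thin_brick_top]). Let b be the vertex of that support closest to c. By
    commutation F is determined by F_b, so F_b != 0, and the arrow above b, if
    any, leaves the root; otherwise its injectivity on V would kill F_b.

    Each F_i, having a one-dimensional or zero source, is injective or zero. On
    the arrows whose source lies in the zero locus of F, the equations for eta
    are solved one vertex at a time from the leaves to the root
    ([solve_to_root]): at a vertex other than c there is one equation, and either
    R_a is injective or V_a is surjective. On the other arrows F_(s a) is injective,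
    so the remaining defect factors as F_(s a) followed by a defect for the
    pair (V, V); as Ext^1(V, V) = 0 the latter is the defect of a family H, and
    the composite of F and H is the required correction. It vanishes where F
    does, so the equations already solved are kept ([thin_dichotomy]). *)

(** * Matrices *)

Section SmallMatrices.
Variable k : fieldType.

Lemma scalar_mx_inj n (x y : k) : n != 0%N -> x%:M = y%:M :> 'M_n -> x = y.
Proof. by case: n => // n _ /matrixP/(_ ord0 ord0); rewrite !mxE eqxx.
Qed.

Lemma row_free_thin m n (F : 'M[k]_(m, n)) : (m <= 1)%N -> F != 0 -> row_free F.
Proof.
rewrite -mxrank_eq0 /row_free; have := rank_leq_row F; lia.
Qed.

Lemma mulmx_dim0 m n p (M : 'M[k]_(m, n)) (N : 'M[k]_(n, p)) :
  n = 0%N -> M *m N = 0.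
Proof. by move=> n0; subst n; rewrite thinmx0 mul0mx. Qed.

Lemma mul_col_row_eq0 m n (u : 'cV[k]_m) (x : 'rV[k]_n) :
  (u *m x == 0) = (u == 0) || (x == 0).
Proof.
apply/idP/orP=> [|[]/eqP->]; rewrite ?mul0mx ?mulmx0 //.
case: (eqVneq x 0) => [|x0 /eqP ux0]; first by right.
left; have fx : row_free x by rewrite /row_free rank_rV x0.
by apply/eqP/(row_free_inj fx); rewrite ux0 mul0mx.
Qed.

End SmallMatrices.

(** * Representations by matrices *)

(** Row vectors are multiplied on the right by the matrices of the arrows. With
    bases chosen, duality is transposition and reverses all arrows, without any
    dual spaces or biduality isomorphisms. *)
Record mxrep (k : fieldType) (I A : finType) (s t : A -> I) := MxRep {
  mxdim :> I -> nat;
  mxmap : forall a : A, 'M[k]_(mxdim (s a), mxdim (t a))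
}.

Section MatrixRepresentations.
Variables (k : fieldType) (I A : finType) (s t : A -> I).
Implicit Types V W : mxrep k s t.

Definition mxhom V W (F : forall i, 'M[k]_(V i, W i)) : Prop :=
  forall a, F (s a) *m mxmap W a = mxmap V a *m F (t a).

Definition mxbrick V : Prop :=
  forall F, @mxhom V V F -> exists c : k, forall i, F i = c%:M.

(** Ext^1(V, W) is the cokernel of the map sending a family (G_i) in the
    product of the Hom(V_i, W_i) to its failure to commute with the arrows. *)
Definition mxext_eq0 V W : Prop :=
  forall eta : (forall a, 'M[k]_(V (s a), W (t a))),
  exists G : (forall i, 'M[k]_(V i, W i)),
  forall a, eta a = G (s a) *m mxmap W a - mxmap V a *m G (t a).

Definition mxthin V : Prop := forall i, (V i <= 1)%N.

Definition mxdual V : mxrep k t s := @MxRep k I A t s V (fun a => (mxmap V a)^T).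

End MatrixRepresentations.

Section Duality.
Variables (k : fieldType) (I A : finType) (s t : A -> I).
Implicit Types V W : mxrep k s t.

Lemma mxhom_dual V W F :
  @mxhom _ _ _ _ _ V W F ->
  @mxhom _ _ _ _ _ (mxdual W) (mxdual V) (fun i => (F i)^T).
Proof. by move=> hF a; rewrite /= -!trmx_mul hF. Qed.

Lemma mxbrick_dual V : mxbrick V -> mxbrick (mxdual V).
Proof.
move=> bV F hF; have [|c Fc] := bV (fun i => (F i)^T).
  by move=> a; have /(congr1 trmx) := hF a; rewrite !trmx_mul /= trmxK.
by exists c => i; rewrite -[F i]trmxK Fc tr_scalar_mx.
Qed.

Lemma mxext_eq0_dual V W : mxext_eq0 V W -> mxext_eq0 (mxdual W) (mxdual V).
Proof.
move=> eVW eta; have [G hG] := eVW (fun a => - (eta a)^T).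
exists (fun i => (G i)^T) => a /=; apply: oppr_inj.
by rewrite -[- eta a]trmxK linearN /= hG linearB /= !trmx_mul opprB.
Qed.

Lemma mxext_eq0_undual V W : mxext_eq0 (mxdual W) (mxdual V) -> mxext_eq0 V W.
Proof.
move=> eVW eta; have [G hG] := eVW (fun a => - (eta a)^T).
exists (fun i => (G i)^T) => a /=; apply: oppr_inj.
by rewrite -[- eta a]trmxK linearN /= hG /= linearB /= !trmx_mul !trmxK opprB.
Qed.

End Duality.

(** * Rooted trees *)

Section RootedTrees.
Variables (I A : finType) (s t : A -> I).

(** The depth l in a rooted tree is unrelated to the orientation of the arrows:
    each arrow is an edge with a lower and an upper end, and it may point either
    way. *)
Definition inward (l : I -> nat) a := (l (t a) < l (s a))%N.
Definition low (l : I -> nat) a := if inward l a then s a else t a.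
Definition high (l : I -> nat) a := if inward l a then t a else s a.

(** Sending an edge to its lower end identifies the edges of the tree with its
    vertices other than the root. *)
Record rooted (c : I) (l : I -> nat) : Prop := Rooted {
  root_depth : l c = 0%N;
  low_depth : forall a, l (low l a) = (l (high l a)).+1;
  low_inj : injective (low l);
  low_surj : forall i, i != c -> exists a, low l a = i
}.

End RootedTrees.

Section RootedOpposite.
Variables (I A : finType) (s t : A -> I) (c : I) (l : I -> nat).
Hypothesis tree : rooted s t c l.

Lemma inward_opp a : inward t s l a = ~~ inward s t l a.
Proof.
have := low_depth tree a; rewrite /inward /low /high /inward.
by case: ltngtP => // ->; lia.
Qed.

Lemma low_opp a : low t s l a = low s t l a.
Proof. by rewrite /low inward_opp; case: inward. Qed.

Lemma high_opp a : high t s l a = high s t l a.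
Proof. by rewrite /high inward_opp; case: inward. Qed.

Lemma rooted_opp : rooted t s c l.
Proof.
case: (tree) => l0 ld li ls; split=> // [a|a a'|i ic].
- by rewrite low_opp high_opp.
- by rewrite !low_opp; apply: li.
- by have [a ai] := ls i ic; exists a; rewrite low_opp.
Qed.

Lemma low_neq_root a : low s t l a != c.
Proof.
by apply/eqP=> e; have := low_depth tree a; rewrite e (root_depth tree).
Qed.

Lemma depth_neq_root i : (0 < l i)%N = (i != c).
Proof.
case: eqP => [->|/eqP ic]; first by rewrite (root_depth tree).
by have [a <-] := low_surj tree ic; rewrite (low_depth tree).
Qed.

(** D consists of the vertices from which iterating the parent map leads to i.
    Removing the edge above i disconnects it from the rest of the tree. *)
Lemma branch_below i : i != c ->
  exists D : pred I, [/\ D i, forall a, low s t l a != i -> D (s a) = D (t a)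
    & forall j, D j -> j != i -> (l i < l j)%N].
Proof.
move=> ic; have /fin_all_exists[p p_low] j : exists j' : I,
    if j == c then j' = c else exists2 a, low s t l a = j & high s t l a = j'.
  case: eqP => [_|/eqP jc]; first by exists c.
  by have [a aj] := low_surj tree jc; exists (high s t l a), a.
have pc : p c = c by have := p_low c; rewrite eqxx.
have p_high a : p (low s t l a) = high s t l a.
  have := p_low (low s t l a); rewrite (negPf (low_neq_root a)).
  by case=> a' /(low_inj tree) -> ->.
have p_depth j : j != c -> l j = (l (p j)).+1.
  by case/(low_surj tree) => a <-; rewrite p_high; apply: low_depth tree a.
exists (fun j => fconnect p j i); split=> [|a ai|j].
- exact: connect0.
- suffices e : fconnect p (low s t l a) i = fconnect p (high s t l a) i.
    by move: e; rewrite /low /high; case: inward.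
  apply/idP/idP=> [/iter_findex|]; rewrite -p_high.
    case: findex => [/eqP|n /= <-]; first by rewrite (negPf ai).
    by rewrite -iterS iterSr fconnect_iter.
  exact: connect_trans (fconnect1 _ _).
have p_le j' n : (l (iter n p j') <= l j')%N.
  elim: n => //= n; apply: leq_trans; case: (eqVneq (iter n p j') c) => [->|h].
    by rewrite pc.
  by rewrite (p_depth _ h).
move/iter_findex; case: findex => [/eqP|n]; first by move->.
rewrite iterSr; case: (eqVneq j c) => [->|/p_depth-> <- _]; last by rewrite ltnS.
by rewrite pc iter_fix // => ci; rewrite -ci eqxx in ic.
Qed.

End RootedOpposite.

(** * Arrows acting on a brick *)

Section Tight.
Variables (k : fieldType) (I A : finType) (c : I) (l : I -> nat).

(** The map of the arrow is injective if it points toward the root, and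
    surjective if it points away from it. *)
Definition tight (s t : A -> I) (V : mxrep k s t) a :=
  if inward s t l a then row_free (mxmap V a) else row_full (mxmap V a).

(** Seen from the root, the support of V is a union of paths. Branching where V
    vanishes has to be allowed: after moving the root into an arm, the centre
    of a star is still a branch point. *)
Definition unbranched (s t : A -> I) (V : mxrep k s t) := forall a a',
  high s t l a = high s t l a' -> high s t l a != c -> V (high s t l a) != 0%N ->
  a = a'.

Section OneOrientation.
Variables (s t : A -> I) (V : mxrep k s t).
Hypothesis tree : rooted s t c l.

Lemma tight_dual a : tight (mxdual V) a = tight V a.
Proof.
rewrite /tight (inward_opp tree) /=.
by case: inward; rewrite /row_free /row_full mxrank_tr.
Qed.

Lemma unbranched_dual : unbranched V -> unbranched (mxdual V).
Proof. by move=> uV a a'; rewrite !(high_opp tree); apply: uV. Qed.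

(** An endomorphism of the restriction of V to the vertices below i, extended by
    zero; only at the edge above i may it fail to commute. It has rank one at i,
    with the line spanned by x as its image. *)
Definition branch_endo i (x : 'rV[k]_(V i)) (g : forall j, 'M[k]_(V j)) :=
  [/\ exists2 u : 'cV[k]_(V i), u != 0 & g i = u *m x,
      forall a, low s t l a != i -> g (s a) *m mxmap V a = mxmap V a *m g (t a)
    & forall j, j != i -> (l j <= l i)%N -> g j = 0].

Definition glue i (x : 'rV[k]_(V i)) (g : forall j, 'M[k]_(V j)) (u : 'cV[k]_(V i))
  : forall j, 'M[k]_(V j) := dfwith g (u *m x).

Definition endo0 : forall j, 'M[k]_(V j) := fun=> 0.

Lemma glue_branch_endo i (x : 'rV[k]_(V i)) (g : forall j, 'M[k]_(V j))
    (u : 'cV[k]_(V i)) :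
    u != 0 ->
    (forall a, low s t l a != i -> high s t l a != i ->
       g (s a) *m mxmap V a = mxmap V a *m g (t a)) ->
    (forall j, j != i -> (l j <= l i)%N -> g j = 0) ->
    (forall a, high s t l a = i -> glue x g u (s a) *m mxmap V a
                                   = mxmap V a *m glue x g u (t a)) ->
  branch_endo x (glue x g u).
Proof.
move=> u0 gc gz gi.
have eo j : j != i -> glue x g u j = g j.
  by move=> ji; rewrite /glue dfwith_out // eq_sym.
split=> [|a ai|j ji]; first by exists u; rewrite /glue ?dfwith_in.
  case: (eqVneq (high s t l a) i) => [|hi]; first exact: gi.
  have [si ti] : s a != i /\ t a != i.
    by move: ai hi; rewrite /low /high; case: ifP.
  by rewrite !eo //; apply: gc.
by rewrite eo //; apply: gz.
Qed.

(** Below i, the support of V is a path on which V is a sum of interval modules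
    all containing i, so an endomorphism of V_i extends as soon as it preserves a
    certain chain of subspaces. Given x, any nonzero functional vanishing on the
    members of the chain that avoid x works. The induction along the path finds it
    without naming the chain. *)
Lemma tight_branch_endo i (x : 'rV[k]_(V i)) :
    unbranched V -> i != c ->
    (forall a, (l i < l (low s t l a))%N -> tight V a) -> x != 0 ->
  exists g, branch_endo x g.
Proof.
move=> uV; pose B := \max_j l j.
have leB j : (l j <= B)%N by apply: leq_bigmax.
have [n] := ubnP (B - l i)%N; elim: n => // n IH in i x * => lt_n ic tV x0.
have Vi : V i != 0%N.
  by apply: contraNneq x0 => Vi; rewrite -mxrank_eq0 -leqn0 -{2}Vi rank_leq_col.
case: (pickP (fun a => high s t l a == i)) => [a /eqP ai|lV]; last first.
  exists (glue x endo0 x^T); apply: glue_branch_endo => [|a _ _|//|a hi].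
  - by rewrite trmx_eq0.
  - by rewrite /endo0 mul0mx mulmx0.
  - by have := lV a; rewrite hi eqxx.
have a_uniq a' : high s t l a' = i -> a' = a.
  by move=> a'i; apply: uV; rewrite ?a'i.
have la : l (low s t l a) = (l i).+1 by rewrite (low_depth tree) ai.
have ta : tight V a by apply: tV; rewrite la.
have glue0 (u : 'cV[k]_(V i)) : u != 0 ->
    glue x endo0 u (s a) *m mxmap V a =
    mxmap V a *m glue x endo0 u (t a) ->
  exists g, branch_endo x g.
  move=> u0 ha; exists (glue x endo0 u).
  apply: glue_branch_endo => [//|*|//|a' /a_uniq->//].
  by rewrite /endo0 mul0mx mulmx0.
have glueg (y : 'rV[k]_(V (low s t l a))) : y != 0 ->
  exists (g : forall j, 'M[k]_(V j)) (v : 'cV[k]_(V (low s t l a))),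
  [/\ v != 0, g (low s t l a) = v *m y & forall u : 'cV[k]_(V i), u != 0 ->
    glue x g u (s a) *m mxmap V a = mxmap V a *m glue x g u (t a) ->
    exists g, branch_endo x g].
  move=> y0; have [|||g [[v v0 gj] gc gz]] := IH _ y _ _ _ y0.
  - by have := leB (low s t l a); rewrite la; lia.
  - exact: low_neq_root tree a.
  - by move=> a' h; apply: tV; lia.
  exists g, v; split=> // u u0 ha; exists (glue x g u).
  apply: glue_branch_endo => // [a' _ hi|j ji lj|a' /a_uniq-> //].
    by apply: gc; apply: contraNneq hi => /(low_inj tree) ->; rewrite ai.
  by apply: gz; [apply: contraTneq lj => ->; rewrite la; lia|lia].
have ji : low s t l a != i by apply/eqP=> h; move: la; rewrite h; lia.
move: ta ai ji glue0 glueg {IH lt_n ic tV Vi a_uniq la}.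
rewrite /tight /low /high; case: ifP => _ fa ai; subst i => ji glue0 glueg.
  (* the arrow comes in from below: if x = y M, the functional found for y is
     extended along the injection M; otherwise take one vanishing on the image *)
  case: (boolP (x <= mxmap V a)%MS) => [/submxP[y xy]|].
    have y0 : y != 0 by apply: contraNneq x0 => y0; rewrite xy y0 mul0mx.
    have [g [v [v0 gs gl]]] := glueg y y0.
    have uv : mxmap V a *m (pinvmx (mxmap V a) *m v) = v.
      by rewrite mulmxA mulmxVp // mul1mx.
    apply: (gl (pinvmx (mxmap V a) *m v)).
      by apply: contraNneq v0 => u0; rewrite -uv u0 mulmx0.
    rewrite /glue dfwith_in dfwith_out 1?eq_sym // gs -mulmxA -xy.
    by rewrite [RHS]mulmxA uv.
  have := mulmx_coker (mxmap V a); rewrite submxE; move: (cokermx _) => C MC xC.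
  have /rowV0Pn[_ /submxP[D ->] u0] : C^T != 0.
    by rewrite trmx_eq0; apply: contraNneq xC => ->; rewrite mulmx0.
  apply: (glue0 (D *m C^T)^T); first by rewrite trmx_eq0.
  rewrite /glue dfwith_in dfwith_out 1?eq_sym // mul0mx trmx_mul trmxK !mulmxA.
  by rewrite MC !mul0mx.
(* the arrow goes down: pull back along it the functional found for x M *)
case: (eqVneq (x *m mxmap V a) 0) => [xM0|xM0].
  apply: (glue0 x^T); rewrite ?trmx_eq0 //.
  by rewrite /glue dfwith_in dfwith_out 1?eq_sym // -mulmxA xM0 !mulmx0.
have [g [v [v0 gt gl]]] := glueg _ xM0.
apply: (gl (mxmap V a *m v)).
  apply: contraNneq v0 => u0.
  by rewrite -[v]mul1mx -(mulVpmx fa) -mulmxA u0 mulmx0.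
by rewrite /glue dfwith_in dfwith_out 1?eq_sym // gt !mulmxA.
Qed.

(** For x in the kernel, an endomorphism below the arrow with image x at its
    source also commutes with the arrow itself. It vanishes at the root, so it
    is not a scalar. *)
Lemma brick_tight_inward a :
    unbranched V -> mxbrick V -> V c != 0%N ->
    (forall a', (l (low s t l a) < l (low s t l a'))%N -> tight V a') ->
  inward s t l a -> row_free (mxmap V a).
Proof.
move=> uV bV Vc tV ina; rewrite -kermx_eq0; apply: contraT => /rowV0Pn[x].
rewrite sub_kermx => /eqP xM x0.
have la : low s t l a = s a by rewrite /low ina.
have sc : s a != c by rewrite -la (low_neq_root tree).
have [|g [[u u0 gs] gc gz]] := tight_branch_endo uV sc _ x0.
  by move=> a' h; apply: tV; rewrite la.
have gt : g (t a) = 0.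
  move: ina; rewrite /inward => ta; apply: gz; last exact: ltnW.
  by apply: contraTneq ta => ->; rewrite ltnn.
have [|d gd] := bV g; first move=> a'.
  case: (eqVneq (low s t l a') (s a)) => [|/gc//]; rewrite -la => /(low_inj tree)->.
  by rewrite gs gt -mulmxA xM !mulmx0.
have d0 : d = 0.
  have := gd c; rewrite gz 1?eq_sym // ?(root_depth tree) //.
  by rewrite -(raddf0 (@scalar_mx k (V c))) => /(scalar_mx_inj Vc).
move: (gd (s a)); rewrite gs d0 -scalemx1 scale0r => /eqP.
by rewrite mul_col_row_eq0 (negPf u0) (negPf x0).
Qed.

End OneOrientation.

(** Transposition exchanges injective arrows toward the root and surjective
    arrows away from it, so the case of inward arrows is enough. The induction
    goes from the leaves to the root. *)
Lemma brick_tight (s t : A -> I) (V : mxrep k s t) :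
    rooted s t c l -> unbranched V -> mxbrick V -> V c != 0%N ->
  forall a, tight V a.
Proof.
move=> tree uV bV Vc a; pose B := \max_j l j.
have leB j : (l j <= B)%N by apply: leq_bigmax.
have [n] := ubnP (B - l (low s t l a))%N; elim: n => // n IH in a * => lt_n.
have tV a' : (l (low s t l a) < l (low s t l a'))%N -> tight V a'.
  by move=> h; apply: IH; have := leB (low s t l a'); lia.
rewrite /tight; case: ifPn => ina; first exact: (brick_tight_inward tree).
have := @brick_tight_inward _ _ (mxdual V) (rooted_opp tree) a.
rewrite (inward_opp tree) /row_free mxrank_tr; apply=> //.
- exact: unbranched_dual.
- exact: mxbrick_dual.
by move=> a'; rewrite !(low_opp tree) tight_dual //; apply: tV.
Qed.

End Tight.

(** * Thin bricks and rigid bricks over a rooted tree *)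

Section Dichotomy.
Variables (k : fieldType) (I A : finType) (s t : A -> I) (c : I) (l : I -> nat).
Hypothesis tree : rooted s t c l.

(** If an arrow acts by zero, projecting to the part of the tree below it is an
    endomorphism; for a brick it is a scalar, so no support is left outside. *)
Lemma brick_cut (V : mxrep k s t) a i : mxbrick V -> mxmap V a = 0 ->
    V (low s t l a) != 0%N -> V i != 0%N -> i != low s t l a ->
  (l (low s t l a) < l i)%N.
Proof.
move=> bV Ma0 Va Vi ia.
have [D [Da Dc Dd]] := branch_below tree (low_neq_root tree a).
have [|d dE] := bV (fun j => if D j then 1%:M else 0).
  move=> a'; case: (eqVneq (low s t l a') (low s t l a)) => [/(low_inj tree)->|].
    by rewrite Ma0 mulmx0 mul0mx.
  by move/Dc->; case: ifP => _; rewrite ?mulmx1 ?mul1mx ?mulmx0 ?mul0mx.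
apply: Dd => //; case: ifPn (dE i) => // _.
rewrite -(raddf0 (@scalar_mx k (V i))) => /(scalar_mx_inj Vi) d0.
have := dE (low s t l a); rewrite Da -d0 => /(scalar_mx_inj Va)/eqP.
by rewrite oner_eq0.
Qed.

Lemma thin_tight (R : mxrep k s t) a : mxthin R ->
    (R (low s t l a) != 0%N -> mxmap R a != 0) -> tight l R a.
Proof.
move=> thR; rewrite /tight /low /row_free /row_full.
have rr := rank_leq_row (mxmap R a); have rc := rank_leq_col (mxmap R a).
have := thR (s a); have := thR (t a); rewrite -mxrank_eq0.
move: (\rank _) rr rc => r rr rc.
case: ifP => _ ? ? h.
  by case: (eqVneq (R (s a)) 0%N) h => [? _|_ /(_ isT)]; lia.
by case: (eqVneq (R (t a)) 0%N) h => [? _|_ /(_ isT)]; lia.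
Qed.

(** With b of minimal depth in the support, an edge acting by zero above another
    support vertex would put b strictly below that vertex by [brick_cut]. *)
Lemma thin_brick_top (R : mxrep k s t) i0 : mxthin R -> mxbrick R -> R i0 != 0%N ->
  exists b, [/\ R b != 0%N, forall i, R i != 0%N -> (l b <= l i)%N
    & forall a, low s t l a != b -> tight l R a].
Proof.
move=> thR bR Ri0; case: (@arg_minnP _ i0 (fun i => R i != 0%N) l Ri0) => b Rb b_min.
exists b; split=> // a ab; apply: thin_tight => // Ra; apply/eqP=> Ma0.
have := brick_cut bR Ma0 Ra Rb; rewrite eq_sym => /(_ ab).
by rewrite ltnNge b_min.
Qed.

(** Visiting the vertices from the leaves to the root, only the equation of the
    edge just below a vertex i remains to be satisfied when choosing G_i, and
    it can be solved for G_i: an arrow a entering i multiplies G_i by the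
    injection R_a, an arrow leaving i by the surjection V_a. The last hypothesis
    makes the equations trivial where several edges meet. *)
Lemma solve_to_root (R V : mxrep k s t) (P : pred A)
    (eta : forall a, 'M[k]_(R (s a), V (t a))) :
    unbranched c l V ->
    (forall a, P a -> high s t l a != c -> V (high s t l a) != 0%N ->
       if inward s t l a then row_free (mxmap R a) else row_full (mxmap V a)) ->
    (forall a, P a -> (high s t l a == c) || (V (high s t l a) == 0%N) ->
       (R (s a) == 0%N) || (V (t a) == 0%N)) ->
  exists G : (forall i, 'M[k]_(R i, V i)),
  forall a, P a -> eta a = G (s a) *m mxmap V a - mxmap R a *m G (t a).
Proof.
move=> uV tP zP; pose B := \max_j l j.
have leB j : (l j <= B)%N by apply: leq_bigmax.
pose sol (G : forall i, 'M[k]_(R i, V i)) a :=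
  eta a = G (s a) *m mxmap V a - mxmap R a *m G (t a).
(* all edges whose upper end has depth at least B - n are solved *)
suffices H n : exists G, forall a, P a -> (B <= l (high s t l a) + n)%N -> sol G a.
  by have [G hG] := H B; exists G => a Pa; apply: hG Pa _; lia.
elim: n => [|n [G hG]].
  exists (fun=> 0) => a Pa; have := leB (low s t l a).
  by rewrite (low_depth tree); lia.
have /fin_all_exists[G1 hG1] i : exists G' : (forall i, 'M[k]_(R i, V i)),
    (forall j, j != i -> G' j = G j) /\
    (forall a, P a -> high s t l a = i -> sol G' a).
  pose G' u : forall j, 'M[k]_(R j, V j) :=
    @dfwith _ (fun j => 'M[k]_(R j, V j)) G i u.
  have G'o u j : j != i -> G' u j = G j.
    by move=> ji; rewrite /G' dfwith_out // eq_sym.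
  case: (boolP ((i == c) || (V i == 0%N))) => [iz|].
    exists G; split=> // a Pa ai; have := zP a Pa; rewrite ai => /(_ iz).
    rewrite /sol; case/orP=> /eqP z.
      by move: (eta a) (G _) (mxmap R a); rewrite z => *; rewrite !flatmx0.
    by move: (eta a) (G (t a)) (mxmap V a); rewrite z => *; rewrite !thinmx0.
  rewrite negb_or => /andP[ic Vi].
  case: (pickP (fun a => P a && (high s t l a == i)))
    => [a /andP[Pa /eqP ai]|nP]; last first.
    by exists G; split=> // a Pa ai; have := nP a; rewrite Pa ai eqxx.
  have ta := tP a Pa; rewrite ai in ta; have {ta} := ta ic Vi.
  have ji : low s t l a != i.
    by apply/eqP=> h; have := low_depth tree a; rewrite ai h; lia.
  suffices: (if inward s t l a then row_free (mxmap R a)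
             else row_full (mxmap V a)) -> exists u, sol (G' u) a.
    move=> H /H[u ha]; exists (G' u); split; first exact: G'o.
    by move=> a' _ a'i; rewrite (uV a' a) ?a'i.
  move: ai ji @G' G'o; rewrite /high /low /sol.
  case: ifP => ina ai; subst i => ji G'o fa.
    exists (pinvmx (mxmap R a) *m (G (s a) *m mxmap V a - eta a)).
    by rewrite G'o // dfwith_in mulmxA mulmxVp // mul1mx opprB addrC subrK.
  exists ((eta a + mxmap R a *m G (t a)) *m pinvmx (mxmap V a)).
  by rewrite (G'o _ (t a)) // dfwith_in -mulmxA mulVpmx // mulmx1 addrK.
exists (fun j => if (l j + n.+1 == B)%N then G1 j j else G j) => a Pa le_a.
have la := low_depth tree a; have lB := leB (low s t l a).
case: (leqP B (l (high s t l a) + n)) => [ha|ha].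
  have := hG a Pa ha; rewrite /sol.
  have -> : (l (s a) + n.+1 == B)%N = false.
    by move: la ha lB; rewrite /low /high; case: ifP; lia.
  have -> // : (l (t a) + n.+1 == B)%N = false.
    by move: la ha lB; rewrite /low /high; case: ifP; lia.
have [G1o /(_ a Pa erefl)] := hG1 (high s t l a); rewrite /sol.
move: la ha le_a lB G1o; rewrite /low /high; case: ifP => _ la ha le_a lB G1o.
  rewrite (G1o (s a)); last by apply/eqP=> e; move: la; rewrite e; lia.
  have -> : (l (s a) + n.+1 == B)%N = false by lia.
  by have -> : (l (t a) + n.+1 == B)%N = true by lia.
rewrite (G1o (t a)); last by apply/eqP=> e; move: la; rewrite e; lia.
have -> : (l (t a) + n.+1 == B)%N = false by lia.
by have -> : (l (s a) + n.+1 == B)%N = true by lia.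
Qed.

(** A nonzero morphism from a thin brick to a rigid brick kills the extensions:
    rigidity of V takes care of the arrows whose source is not killed by F, and
    the maps of R and V take care of the others. *)
Theorem thin_dichotomy (R V : mxrep k s t) :
    unbranched c l V -> mxbrick V -> mxext_eq0 V V -> V c != 0%N ->
    mxthin R -> mxbrick R ->
  forall F : (forall i, 'M[k]_(R i, V i)), mxhom F -> (exists i, F i != 0) ->
  mxext_eq0 R V.
Proof.
move=> uV bV eV Vc thR bR F hF [i0 Fi0] eta.
have tV := brick_tight tree uV bV Vc.
have Ri0 : R i0 != 0%N.
  by apply: contraNneq Fi0 => Ri0; rewrite -mxrank_eq0 -leqn0 -Ri0 rank_leq_row.
have [b [Rb b_min tR]] := thin_brick_top thR bR Ri0.
have Rc0 : b != c -> R c = 0%N.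
  move=> bc; apply: contraNeq bc => /b_min; rewrite (root_depth tree) => lb.
  by rewrite -[_ == _]negbK -(depth_neq_root tree) -leqNgt.
have F_spread : F b = 0 -> forall i, F i = 0.
  move=> Fb i; have [n] := ubnP (l i); elim: n i => // n IH i lt_n.
  case: (eqVneq i b) => [->//|ib]; case: (eqVneq (R i) 0%N) => [Ri|Ri].
    by move: (F i); rewrite Ri => Fi; apply: flatmx0.
  have ic : i != c.
    apply: contraNneq Ri => ic; rewrite ic; apply/eqP/Rc0.
    by rewrite -ic eq_sym.
  have [a ai] := low_surj tree ic; have := tR a; rewrite ai => /(_ ib).
  have := tV a; have la := low_depth tree a; have := hF a.
  have: F (high s t l a) = 0 by apply: IH; move: lt_n; rewrite -ai la; lia.
  move: ai; rewrite /tight /high /low; case: ifP => _ ai; subst i => Fh; rewrite Fh.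
    by rewrite mulmx0 => FN fN _; apply: (row_free_inj fN); rewrite FN mul0mx.
  by rewrite mul0mx => FN _ fM; apply: (row_full_inj fM); rewrite -FN mulmx0.
have Fb : F b != 0 by apply: contraNneq Fi0 => /F_spread->.
(* the arrow above b points away from the root *)
have b_out a : inward s t l a -> low s t l a != b.
  move=> ina; apply: contraNneq Fb => ab; rewrite -ab; have := hF a; have := tV a.
  have /eqP : R (high s t l a) == 0%N.
    by apply: contraT => /b_min; rewrite -ab (low_depth tree) ltnn.
  rewrite /tight /low /high ina => Rt fN FN; apply/eqP/(row_free_inj fN).
  by rewrite FN mul0mx mulmx_dim0.
have [||G hG] := @solve_to_root R V (fun a => F (s a) == 0) eta uV.
- move=> a _ _ _; case: ifP (tV a) (tR a) => ina; rewrite /tight ina => //.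
  by move=> _; apply; apply: b_out.
- move=> a /eqP Fa; case: (eqVneq (V (high s t l a)) 0%N) => [Vh _|Vh].
    have := tV a; move: Vh; rewrite /tight /high; case: ifP => _ Vh.
      by move=> _; rewrite Vh orbT.
    by have := rank_leq_row (mxmap V a); rewrite /row_full; lia.
  (* at the root: an arrow a entering c from a zero of F has R_a F_c = 0, hence
     R_a = 0 if F_c is injective; as R_a is injective, its source is zero *)
  rewrite orbF => /eqP; have := b_out a; have := tR a; rewrite /tight /high /low.
  case: ifP => [ina tRa /(_ isT) ab hc|_ _ _ hc]; last first.
    have cb : b != c by apply: contraNneq Fb => bc; rewrite bc -hc Fa.
    by rewrite hc Rc0.
  have := tRa ab; rewrite /row_free.
  case: (eqVneq b c) => [bc|/Rc0 Rc]; last first.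
    by have := rank_leq_col (mxmap R a); have Rt : R (t a) = 0%N; [rewrite hc | lia].
  have fF : row_free (F (t a)) by apply: row_free_thin; rewrite // hc -bc.
  suffices -> : mxmap R a = 0 by rewrite mxrank0 eq_sym => ->.
  by apply: (row_free_inj fF); rewrite mul0mx -hF Fa mul0mx.
(* the remaining defect factors through F *)
have /fin_all_exists[Z hZ] a : exists Z : 'M[k]_(V (s a), V (t a)),
    F (s a) *m Z = eta a - (G (s a) *m mxmap V a - mxmap R a *m G (t a)).
  case: (eqVneq (F (s a)) 0) => [Fa|Fa].
    by exists 0; rewrite mulmx0 (hG a) ?Fa // subrr.
  have fF := row_free_thin (thR _) Fa.
  move: (eta a - _) => r; exists (pinvmx (F (s a)) *m r).
  by rewrite mulmxA mulmxVp // mul1mx.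
have [H hH] := eV Z; exists (fun i => G i + F i *m H i) => a.
rewrite mulmxDl mulmxDr opprD addrACA -mulmxA [mxmap R a *m (_ *m _)]mulmxA -hF.
by rewrite -mulmxA -mulmxBr -hH hZ addrC subrK.
Qed.

End Dichotomy.

(** * Stars and their rerooting *)

Section Stars.
Variables (I A : finType) (s t : A -> I).

(** Coordinates on a star: the depth l is the distance to the centre and al
    names the arm. The value of al at the centre is arbitrary. *)
Record star_coord (c : I) (l al : I -> nat) : Prop := StarCoord {
  star_rooted : rooted s t c l;
  same_arm : forall a, high s t l a != c -> al (low s t l a) = al (high s t l a);
  star_inj : forall i j, i != c -> j != c -> al i = al j -> l i = l j -> i = j
}.

Variables (c : I) (l al : I -> nat).
Hypothesis star : star_coord c l al.
Let tree := star_rooted star.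

Lemma star_high_inj a a' :
  high s t l a = high s t l a' -> high s t l a != c -> a = a'.
Proof.
move=> e ac; apply: (low_inj tree); apply: (star_inj star); rewrite ?(low_neq_root tree) //.
  by rewrite !(same_arm star) // -e.
by rewrite !(low_depth tree) e.
Qed.

Lemma star_unbranched (k : fieldType) (V : mxrep k s t) : unbranched c l V.
Proof. by move=> a a' e ac _; apply: star_high_inj. Qed.

Section Reroot.
Variable x : I.
Hypothesis xc : x != c.

(** The distance to x in the star. Both truncated differences are written since
    their sum is the absolute value of the difference of depths. *)
Definition star_dist i :=
  (if (al i == al x) && (i != c) then (l i - l x) + (l x - l i) else l i + l x)%N.

(** The edges between x and the centre are those whose ends are exchanged when
    the root moves from the centre to x. *)
Let between a := (al (low s t l a) == al x) && (l (low s t l a) <= l x)%N.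

Let step_dist a :
  if between a then star_dist (high s t l a) = (star_dist (low s t l a)).+1
  else star_dist (low s t l a) = (star_dist (high s t l a)).+1.
Proof.
rewrite /between /star_dist (low_neq_root tree) andbT.
have la := low_depth tree a; have lx : (0 < l x)%N by rewrite (depth_neq_root tree).
case: (eqVneq (high s t l a) c) => [ac|ac].
  rewrite ac (root_depth tree) in la *; rewrite andbF.
  by case: (al _ == _) => /=; [case: ifP|]; lia.
rewrite -(same_arm star ac) andbT; have := ac; rewrite -(depth_neq_root tree) => lh.
by case: (al _ == _) => /=; [case: ifP|]; lia.
Qed.

Let low_dist a :
  low s t star_dist a = if between a then high s t l a else low s t l a.
Proof.
have := step_dist a; move: (between a) => b; rewrite /low /high /inward.
by case: (ltnP (l (t a))) => _; case: b => /= e; case: ltnP => //; lia.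
Qed.

Let high_dist a :
  high s t star_dist a = if between a then low s t l a else high s t l a.
Proof.
have := step_dist a; move: (between a) => b; rewrite /low /high /inward.
by case: (ltnP (l (t a))) => _; case: b => /= e; case: ltnP => //; lia.
Qed.

Let edge_between i : (l i < l x)%N -> (i != c -> al i = al x) ->
  exists2 a, between a & high s t l a = i.
Proof.
move=> li ali.
have walk n : (n < l x)%N ->
    exists a, l (low s t l a) = (l x - n)%N /\ al (low s t l a) = al x.
  elim: n => [|n IH] ln; first by have [a <-] := low_surj tree xc; exists a; rewrite subn0.
  have [a [la ala]] := IH (ltnW ln); have lh := low_depth tree a.
  have hc : high s t l a != c by rewrite -(depth_neq_root tree); lia.
  have [a' a'h] := low_surj tree hc; exists a'.
  by rewrite a'h -(same_arm star hc); split=> //; lia.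
have [|a [la ala]] := walk (l x - l i).-1; first by lia.
exists a; first by rewrite /between ala eqxx la; lia.
have lh := low_depth tree a; case: (eqVneq i c) => [ic|ic].
  apply/eqP; rewrite ic -[_ == _]negbK -(depth_neq_root tree).
  by move: li la; rewrite ic (root_depth tree); lia.
have := ic; rewrite -(depth_neq_root tree) => li0.
have hc : high s t l a != c by rewrite -(depth_neq_root tree); lia.
by apply: (star_inj star) => //; [rewrite -(same_arm star hc) ala ali|lia].
Qed.

Lemma star_reroot : rooted s t x star_dist.
Proof.
have lx : (0 < l x)%N by rewrite (depth_neq_root tree).
split=> [|a|a a'|i ix].
- by rewrite /star_dist eqxx xc /=; lia.
- by have := step_dist a; rewrite low_dist high_dist; case: ifP.
- have mixed b b' : between b -> ~~ between b' -> high s t l b <> low s t l b'.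
    move=> bb /negP nb' e; apply: nb'; rewrite /between -e.
    have hc : high s t l b != c by rewrite e (low_neq_root tree).
    move: bb; rewrite /between (same_arm star hc) (low_depth tree) => /andP[-> /ltnW].
    by [].
  rewrite !low_dist; case: ifPn => ba; case: ifPn => ba'.
  + move=> e; case: (eqVneq (high s t l a) c) => [ac|]; last exact: star_high_inj.
    apply: (low_inj tree); apply: (star_inj star); rewrite ?(low_neq_root tree) //.
      by case/andP: ba => /eqP-> _; case/andP: ba' => /eqP->.
    by rewrite !(low_depth tree) e.
  + by move/(mixed _ _ ba ba').
  + by move/esym/(mixed _ _ ba' ba).
  + exact: (low_inj tree).
case: (boolP ((l i < l x)%N && ((i == c) || (al i == al x)))) => [/andP[li ali]|ni].
  have [|a ba <-] := edge_between li; last by exists a; rewrite low_dist ba.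
  by move=> ic; move: ali; rewrite (negPf ic) => /eqP.
have ic : i != c.
  by apply: contraNneq ni => ->; rewrite eqxx (root_depth tree) lx.
have [a ai] := low_surj tree ic; exists a; rewrite low_dist ifN // /between ai.
apply: contraNN ni => /andP[al_i li]; rewrite al_i orbT andbT ltn_neqAle li andbT.
by apply: contraNneq ix => lix; apply/eqP/(star_inj star) => //; apply/eqP.
Qed.

(** A vertex of the arm of x has at most two neighbours, and one of them lies
    toward x. *)
Lemma star_reroot_unbranched (k : fieldType) (V : mxrep k s t) :
    (forall i, V i != 0%N -> i != c /\ al i = al x) ->
  unbranched x star_dist V.
Proof.
move=> suppV a a' e ax Va; have [ic ali] := suppV _ Va.
have mixed b b' : between b -> ~~ between b' -> low s t l b = high s t l b' ->
    low s t l b != x -> al (low s t l b) = al x -> False.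
  move=> /andP[_ lb] + h bx alb; rewrite /between.
  have hc : high s t l b' != c by rewrite -h (low_neq_root tree).
  rewrite (same_arm star hc) -h alb eqxx (low_depth tree) -h -ltnNge ltnS => xb.
  case/eqP: bx; apply: (star_inj star); rewrite ?(low_neq_root tree) //.
  by apply/eqP; rewrite eqn_leq lb.
move: e ax ic ali; rewrite !high_dist; case: ifPn => ba; case: ifPn => ba'.
- by move=> /(low_inj tree).
- by move=> e ax _ ali; case: (mixed _ _ ba ba' e ax ali).
- by move=> e; rewrite e => ax _ ali; case: (mixed _ _ ba' ba (esym e) ax ali).
- by move=> e _ ic _; apply: star_high_inj e ic.
Qed.

End Reroot.

(** If V vanishes at the centre, the projection to an arm is an endomorphism. *)
Lemma brick_in_arm (k : fieldType) (V : mxrep k s t) x : mxbrick V ->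
    V c = 0%N -> V x != 0%N -> forall i, V i != 0%N -> i != c /\ al i = al x.
Proof.
move=> bV Vc Vx i Vi; have nc j : V j != 0%N -> j != c.
  by apply: contraNneq => ->; apply/eqP.
split; first exact: nc; pose g j : 'M[k]_(V j) := ((al j == al x)%:R)%:M.
have [a|d gd] := bV g.
  case: (eqVneq (high s t l a) c) => [hc|hc].
    have [z|z] : V (s a) = 0%N \/ V (t a) = 0%N.
    - by move: hc; rewrite /high; case: ifP => _ ->; [right|left].
    - by move: (g _) (mxmap V a); rewrite z => *; rewrite !flatmx0.
    by move: (g (t a)) (mxmap V a); rewrite z => *; rewrite !thinmx0.
  rewrite /g; have := same_arm star hc; rewrite /low /high; case: ifP => _ ->;
  by rewrite mul_scalar_mx mul_mx_scalar.
have := gd x; rewrite /g eqxx => /(scalar_mx_inj Vx) d1.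
have := gd i; rewrite /g -d1 => /(scalar_mx_inj Vi) e1.
by apply/eqP; case: eqP e1 => // _ /eqP; rewrite eq_sym oner_eq0.
Qed.

(** The centre serves as the root when V does not vanish there; otherwise any
    vertex where F is nonzero does. *)
Theorem star_dichotomy (k : fieldType) (R V : mxrep k s t) :
    mxbrick V -> mxext_eq0 V V -> mxthin R -> mxbrick R ->
  forall F : (forall i, 'M[k]_(R i, V i)), mxhom F -> (exists i, F i != 0) ->
  mxext_eq0 R V.
Proof.
move=> bV eV thR bR F hF F0; case: (eqVneq (V c) 0%N) => [Vc|Vc]; last first.
  exact: (thin_dichotomy tree (@star_unbranched k V) bV eV Vc thR bR hF F0).
case: (F0) => x Fx; have Vx : V x != 0%N.
  by apply: contraNneq Fx => Vx; rewrite -mxrank_eq0 -leqn0 -Vx rank_leq_col.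
have suppV := brick_in_arm bV Vc Vx; have [xc _] := suppV x Vx.
exact: (thin_dichotomy (star_reroot xc) (star_reroot_unbranched xc suppV)
  bV eV Vx thR bR hF F0).
Qed.

End Stars.

Lemma star_coord_opp (I A : finType) (s t : A -> I) c l al :
  star_coord s t c l al -> star_coord t s c l al.
Proof.
case=> tree arm inj; split=> //; first exact: rooted_opp.
by move=> a; rewrite (high_opp tree) (low_opp tree); apply: arm.
Qed.

(** * Depth and arms in the star quiver *)

Section StarQuiver.
Variables m n p : nat.

Definition star_depth (i : star_vertex m n p) : nat :=
  match i with
  | None => 0
  | Some (inl (inl i)) => m.-1 - i
  | Some (inl (inr i)) => n.-1 - i
  | Some (inr i) => p.-1 - i
  end.

Definition star_arm (i : star_vertex m n p) : nat :=
  match i with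
  | None => 0
  | Some (inl (inl _)) => 0
  | Some (inl (inr _)) => 1
  | Some (inr _) => 2
  end.

Lemma star_depth_next x : star_depth (Some x) = (star_depth (star_next x)).+1.
Proof.
by case: x => [[]|] i /=; case: insubP => [j _|] /= ij; have := ltn_ord i; lia.
Qed.

Lemma star_arm_next x :
  star_next x <> None -> star_arm (Some x) = star_arm (star_next x).
Proof. by case: x => [[]|] i /=; case: insubP. Qed.

Lemma star_vertex_inj x y : star_arm (Some x) = star_arm (Some y) ->
  star_depth (Some x) = star_depth (Some y) -> x = y.
Proof.
have ord_eq q (i j : 'I_q.-1) : (q.-1 - i = q.-1 - j)%N -> i = j.
  move=> e; apply: ord_inj; have := ltn_ord i; have := ltn_ord j; lia.
by case: x y => [[]|] i [[]|] j //= _ /ord_eq->.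
Qed.

End StarQuiver.

Lemma three_arm_star_coord (Q : quiver) : three_arm_star Q ->
  exists c l al, star_coord (@src Q) (@tgt Q) c l al.
Proof.
case=> m [n [p [_ _ _ [phi [psi [[phi' phiK phiK'] [psi' psiK psiK'] adj]]]]]].
pose l i := star_depth (phi i); pose al i := star_arm (phi i).
have ends a : phi (low src tgt l a) = Some (psi a) /\
              phi (high src tgt l a) = star_next (psi a).
  have := star_depth_next (psi a); rewrite /low /high /inward /l.
  case: (adj a) => -[e1 e2] e; rewrite e1 e2 e.
    by rewrite ltnSn e1 e2.
  by rewrite ltnNge leqnSn /= e1 e2.
have not_root i : i != phi' None -> exists x, phi i = Some x.
  case e: (phi i) => [x|]; first by exists x.
  by rewrite -e phiK eqxx.
exists (phi' None), l, al; split; first split.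
- by rewrite /l phiK'.
- by move=> a; have [e1 e2] := ends a; rewrite /l e1 e2 star_depth_next.
- move=> a a' e; have [e1 _] := ends a; have [e2 _] := ends a'.
  by apply: (can_inj psiK); move: e2; rewrite -e e1 => -[].
- move=> i /not_root[x ix]; exists (psi' x); apply: (can_inj phiK).
  by have [-> _] := ends (psi' x); rewrite psiK' ix.
- move=> a hc; have [e1 e2] := ends a; rewrite /al e1 e2; apply: star_arm_next.
  by rewrite -e2; have [x ->] := not_root _ hc.
- move=> i j /not_root[x ix] /not_root[y jy]; rewrite /l /al ix jy => e1 e2.
  by apply: (can_inj phiK); rewrite ix jy (star_vertex_inj e1 e2).
Qed.

(** * Extensions of representations and cocycles *)

Section Representations.
Variables (k : fieldType) (Q : quiver).
Implicit Types V W : rep k Q.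

Definition cocycles_split V W : Prop :=
  forall eta : (forall a : arrow Q, 'Hom(V (src a), W (tgt a))),
  exists h : (forall i, 'Hom(V i, W i)),
  forall a, eta a = (rmap W a \o h (src a))%VF - (h (tgt a) \o rmap V a)%VF.

Section PairMaps.
Variables A C : vectType k.

Definition inl_fun (x : A) : A * C := (x, 0).
Lemma inl_fun_linear : linear inl_fun.
Proof. by move=> a x y; congr (_, _); rewrite /= scaler0 addr0. Qed.
HB.instance Definition _ :=
  GRing.isLinear.Build k A (A * C)%type *:%R inl_fun inl_fun_linear.

Definition snd_fun (x : A * C) : C := x.2.
Lemma snd_fun_linear : linear snd_fun.
Proof. by []. Qed.
HB.instance Definition _ :=
  GRing.isLinear.Build k (A * C)%type C *:%R snd_fun snd_fun_linear.

End PairMaps.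

Section Twisted.
Variables (V W : rep k Q) (eta : forall a : arrow Q, 'Hom(V (src a), W (tgt a))).

(** The extension with class eta: the direct sum with its maps made block
    triangular, eta being the off-diagonal block. *)
Definition twist_fun a (x : V (src a) * W (src a)) : V (tgt a) * W (tgt a) :=
  (rmap V a x.1, eta a x.1 + rmap W a x.2).
Lemma twist_fun_linear a : linear (@twist_fun a).
Proof.
move=> c x y; rewrite /twist_fun /= !linearP; congr (_, _).
by rewrite /= scalerDr addrACA.
Qed.
HB.instance Definition _ a :=
  GRing.isLinear.Build k (V (src a) * W (src a))%type (V (tgt a) * W (tgt a))%type
    *:%R (@twist_fun a) (@twist_fun_linear a).

Definition twisted_sum : rep k Q :=
  @Rep k Q (fun i => (V i * W i)%type) (fun a => linfun (@twist_fun a)).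

Lemma twisted_in_comm (a : arrow Q) :
  (linfun (@inr_fun k (V (tgt a)) (W (tgt a))) \o rmap W a)%VF
  = (rmap twisted_sum a \o linfun (@inr_fun k (V (src a)) (W (src a))))%VF.
Proof.
apply/lfunP=> x; rewrite !comp_lfunE !lfunE /= /twist_fun /inr_fun /=.
by rewrite !linear0 add0r.
Qed.

Lemma twisted_out_comm (a : arrow Q) :
  (linfun (@fst_fun k (V (tgt a)) (W (tgt a))) \o rmap twisted_sum a)%VF
  = (rmap V a \o linfun (@fst_fun k (V (src a)) (W (src a))))%VF.
Proof. by apply/lfunP=> x; rewrite !comp_lfunE !lfunE. Qed.

Definition twisted_in : rep_hom W twisted_sum :=
  @RepHom k Q W twisted_sum (fun i => linfun (@inr_fun k (V i) (W i)))
    twisted_in_comm.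
Definition twisted_out : rep_hom twisted_sum V :=
  @RepHom k Q twisted_sum V (fun i => linfun (@fst_fun k (V i) (W i)))
    twisted_out_comm.

Definition twisted_ext : extension V W :=
  @Extension k Q V W twisted_sum twisted_in twisted_out
    (@sum_in_inj k Q V W) (@sum_exact k Q V W) (@sum_out_surj k Q V W).

End Twisted.

(** An equivalence from the twisted sum to the direct sum is unipotent, and its
    off-diagonal block writes eta as a defect of commutation. *)
Lemma Ext1_eq0_split V W : Ext1_eq0 V W -> cocycles_split V W.
Proof.
move=> eVW eta; have [h hE] := eVW (twisted_ext eta).
pose inl i := linfun (@inl_fun (V i) (W i)).
pose f i := (linfun (@snd_fun (V i) (W i)) \o h i \o inl i)%VF.
have fE i x : f i x = (h i (x, 0)).2 by rewrite !comp_lfunE !lfunE.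
clearbody f.
have h_in i y : h i (0, y) = (0, y).
  have [/lfunP/(_ y) + _] := hE i.
  by rewrite comp_lfunE !lfunE.
have h_out i z : (h i z).1 = z.1.
  have [_ /lfunP/(_ z)] := hE i.
  by rewrite comp_lfunE !lfunE.
have hD i x y : h i (x, y) = (x, f i x + y).
  have -> : (x, y) = (x, 0) + (0, y) :> (V i * W i)%type.
    by congr (_, _); rewrite /= ?addr0 ?add0r.
  rewrite linearD /= h_in; have := h_out i (x, 0); rewrite fE.
  by case: (h i (x, 0)) => x' y' /= ->; congr (_, _); rewrite /= addr0.
exists f => a; apply/lfunP=> x.
have /lfunP/(_ (x, 0)) := hom_comm h a.
rewrite !comp_lfunE !lfunE /= /twist_fun /pair_fun /= linear0 addr0 !hD addr0 /=.
by case=> e; rewrite opp_lfunE !comp_lfunE -e addrAC subrr add0r.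
Qed.

(** Linear sections s of the surjections commute with the arrows up to a family
    eta with values in W. Writing eta as a defect corrects s to a morphism of
    representations, which splits the extension. *)
Lemma split_Ext1_eq0 V W : cocycles_split V W -> Ext1_eq0 V W.
Proof.
move=> cVW e; pose E := ext_mid e.
have in_inj i : injective (ext_in e i) by apply/lker0P/eqP/ext_in_inj.
have out_in i y : ext_out e i (ext_in e i y) = 0.
  by apply/eqP; rewrite -memv_ker -ext_exact memv_img ?memvf.
pose s i := ((ext_out e i)^-1)%VF; pose r i := ((ext_in e i)^-1)%VF.
have sK i x : ext_out e i (s i x) = x.
  by apply: limg_lfunVK; rewrite ext_out_surj memvf.
have inK i z : ext_out e i z = 0 -> ext_in e i (r i z) = z.
  by move=> z0; apply: limg_lfunVK; rewrite ext_exact memv_ker z0.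
have inC a y : ext_in e (tgt a) (rmap W a y) = rmap E a (ext_in e (src a) y).
  by have /lfunP/(_ y) := hom_comm (ext_in e) a; rewrite !comp_lfunE.
have outC a z : ext_out e (tgt a) (rmap E a z) = rmap V a (ext_out e (src a) z).
  by have /lfunP/(_ z) := hom_comm (ext_out e) a; rewrite !comp_lfunE.
pose eta a := (r (tgt a) \o ((rmap E a \o s (src a)) - (s (tgt a) \o rmap V a)))%VF.
have etaE a x : ext_in e (tgt a) (eta a x) = rmap E a (s _ x) - s _ (rmap V a x).
  rewrite comp_lfunE inK.
    by rewrite !lfunE /= !lfunE /= lfunE.
  by rewrite !lfunE /= !lfunE /= lfunE linearB /= sK outC sK subrr.
have [f hf] := cVW eta.
pose s' i := (s i - (ext_in e i \o f i))%VF.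
have s'E i x : s' i x = s i x - ext_in e i (f i x).
  by rewrite !lfunE /= !lfunE /= lfunE.
have s'K i x : ext_out e i (s' i x) = x.
  by rewrite s'E linearB /= sK out_in subr0.
have s'C a x : rmap E a (s' _ x) = s' _ (rmap V a x).
  rewrite !s'E linearB /= -inC; have := etaE a x; rewrite hf.
  rewrite add_lfunE opp_lfunE !comp_lfunE linearB /= => e1.
  apply/eqP; rewrite subr_eq addrAC -addrA addrC -subr_eq; apply/eqP.
  by rewrite -e1.
pose t i := (r i \o (\1 - (s' i \o ext_out e i)))%VF.
have tE i z : t i z = r i (z - s' i (ext_out e i z)).
  by rewrite comp_lfunE add_lfunE opp_lfunE comp_lfunE id_lfunE.
have t_in i z : ext_in e i (t i z) = z - s' i (ext_out e i z).
  by rewrite tE inK // linearB /= s'K subrr.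
clearbody t s'.
pose h i := ((linfun (@inl_fun (V i) (W i)) \o ext_out e i)
             + (linfun (@inr_fun k (V i) (W i)) \o t i))%VF.
have hE i z : h i z = (ext_out e i z, t i z).
  rewrite add_lfunE !comp_lfunE !lfunE.
  by congr (_, _); rewrite /= ?addr0 ?add0r.
have h_comm a :
    (h (tgt a) \o rmap E a)%VF = (rmap (rep_sum V W) a \o h (src a))%VF.
  apply/lfunP=> z; rewrite !comp_lfunE !hE !lfunE /= /pair_fun /= outC.
  congr (_, _); apply: in_inj.
  by rewrite inC !t_in linearB /= s'C outC.
exists (@RepHom k Q E (rep_sum V W) h h_comm) => i; split; apply/lfunP=> x.
  rewrite comp_lfunE /= hE !lfunE /= /inr_fun out_in; congr (_, _).
  by apply: in_inj; rewrite t_in out_in linear0 subr0.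
by rewrite comp_lfunE /= hE !lfunE.
Qed.

End Representations.

(** * Passing to matrices *)

Section Matrices.
Import VectorInternalTheory.
Variable k : fieldType.

Definition mx2f (U W : vectType k) (M : 'M[k]_(dim U, dim W)) : 'Hom(U, W) :=
  Hom M.

Lemma mx2fE (U W : vectType k) (M : 'M[k]_(dim U, dim W)) x :
  mx2f M x = r2v (v2r x *m M).
Proof. by rewrite unlock. Qed.

Lemma f2mxK (U W : vectType k) (f : 'Hom(U, W)) : mx2f (f2mx f) = f.
Proof. by case: f. Qed.

Lemma f2mx_comp (U V W : vectType k) (f : 'Hom(V, W)) (g : 'Hom(U, V)) :
  f2mx (f \o g)%VF = f2mx g *m f2mx f.
Proof.
rewrite -[RHS]/(f2mx (mx2f _)); congr f2mx; apply/lfunP=> x.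
rewrite comp_lfunE -[f in LHS]f2mxK -[g in LHS]f2mxK !mx2fE r2vK.
by rewrite mulmxA.
Qed.

Lemma f2mx_sub (V W : vectType k) (f g : 'Hom(V, W)) :
  f2mx (f - g) = f2mx f - f2mx g.
Proof.
rewrite -[RHS]/(f2mx (mx2f _)); congr f2mx; apply/lfunP=> x.
rewrite add_lfunE opp_lfunE -[f in LHS]f2mxK -[g in LHS]f2mxK !mx2fE.
by rewrite mulmxBr linearB.
Qed.

Lemma f2mx_scalar (V : vectType k) (c : k) :
  f2mx (c *: \1 : 'Hom(V, V))%VF = c%:M.
Proof.
rewrite -[RHS]/(f2mx (mx2f _)); congr f2mx; apply/lfunP=> x.
by rewrite scale_lfunE id_lfunE mx2fE mul_mx_scalar linearZ /= v2rK.
Qed.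

Variable Q : quiver.
Implicit Types V W : rep k Q.

Definition mx_of V : mxrep k (@src Q) (@tgt Q) :=
  MxRep (mxdim := fun i => dim (V i)) (fun a => f2mx (rmap V a)).

Lemma mxhom_of V W (h : rep_hom V W) :
  @mxhom _ _ _ _ _ (mx_of V) (mx_of W) (fun i => f2mx (h i)).
Proof. by move=> a; have /(congr1 f2mx) := hom_comm h a; rewrite !f2mx_comp. Qed.

Lemma mxbrick_of V : End_eq_scalars V -> mxbrick (mx_of V).
Proof.
move=> sV F hF.
have comm a : (@mx2f (V _) (V _) (F (tgt a)) \o rmap V a)%VF
    = (rmap V a \o @mx2f (V _) (V _) (F (src a)))%VF.
  by apply: (can_inj (@f2mxK _ _)); rewrite !f2mx_comp /= (hF a).
have [c [cE _]] := sV (@RepHom k Q V V (fun i => @mx2f (V i) (V i) (F i)) comm).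
by exists c => i; have := congr1 f2mx (cE i); rewrite f2mx_scalar.
Qed.

Lemma mxext_eq0_of V W : Ext1_eq0 V W -> mxext_eq0 (mx_of V) (mx_of W).
Proof.
move=> eVW eta.
have [h hE] := Ext1_eq0_split eVW (fun a => @mx2f (V _) (W _) (eta a)).
exists (fun i => f2mx (h i)) => a; have := congr1 f2mx (hE a).
by rewrite f2mx_sub !f2mx_comp.
Qed.

Lemma Ext1_eq0_of V W : mxext_eq0 (mx_of V) (mx_of W) -> Ext1_eq0 V W.
Proof.
move=> eVW; apply: split_Ext1_eq0 => eta.
have [G hG] := eVW (fun a => f2mx (eta a)).
exists (fun i => @mx2f (V i) (W i) (G i)) => a; apply: (can_inj (@f2mxK _ _)).
by rewrite f2mx_sub !f2mx_comp hG.
Qed.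

Lemma mxthin_of V : thin V -> mxthin (mx_of V).
Proof. by move=> tV i; have := tV i; rewrite dimvf. Qed.

Lemma f2mx_eq0 (V W : vectType k) (f : 'Hom(V, W)) : f2mx f = 0 -> f = 0.
Proof.
by move=> f0; rewrite -(subrr f) -[f - f]f2mxK f2mx_sub subrr -f0 f2mxK.
Qed.

End Matrices.

Theorem corollary6p6 (k : closedFieldType) (Q : quiver)
  (hQ : three_arm_star Q) (rho rho' : rep k Q)
  (hrho : exceptional rho) (hrho' : exceptional rho')
  (hthin : thin rho \/ thin rho') :
  Hom_eq0 rho rho' \/ Ext1_eq0 rho rho'.
Proof.
case: hrho hrho' => /mxbrick_of b /mxext_eq0_of e [/mxbrick_of b' /mxext_eq0_of e'].
have [c [l [al star]]] := three_arm_star_coord hQ.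
have [?|nHom] := classic (Hom_eq0 rho rho'); [by left | right].
have [f [i fi]] : exists (f : rep_hom rho rho') i, f i <> 0.
  apply: NNPP => nf; apply: nHom => f i; apply: NNPP => fi.
  by apply: nf; exists f, i.
have hf := mxhom_of f.
have {}fi : VectorInternalTheory.f2mx (f i) != 0 by apply/eqP => /f2mx_eq0.
apply: Ext1_eq0_of; case: hthin => /mxthin_of th.
  by apply: (star_dichotomy star b' e' th b hf); exists i.
(* for rho' thin, the transpose of f goes from the thin dual of rho' *)
apply: mxext_eq0_undual.
apply: (star_dichotomy (star_coord_opp star) (mxbrick_dual b) (mxext_eq0_dual e)
  _ (mxbrick_dual b') (mxhom_dual hf)); first exact: th.
by exists i; rewrite trmx_eq0.
Qed.
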